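(* Let $C=(C_n)_{n\ge1}$ be a strong divisibility sequence and let $p$ be an acceptable prime for $C$, with an integer $s(p)\ge1$ as in the definition of acceptable. Then for any integer $n\ge0$ with standard base-$p$ representation $n=n_\ell\cdots n_1n_0$, and for any integer $0\le r<\alpha(p^{s(p)})$, \[ T_{p,C}(\alpha(p^{s(p)})\cdot n+r,x)=u_{p,C}(r)\,M_p(n_0)M_p(n_1)\cdots M_p(n_\ell)\begin{bmatrix}1\\0\end{bmatrix}, \] where $u_{p,C}(r)=\begin{bmatrix}u_{p,C,0}(r)&u_{p,C,1}(r)\end{bmatrix}$ with \[ u_{p,C,\lambda}(r)=\sum_{\substack{(r_1,r_2)\in\{0,1,\dots,\alpha(p^{s(p)})-1\}^2\\ r_1+r_2=r+\lambda\alpha(p^{s(p)})}} x^{f_{p,C,\lambda}(r,r_1,r_2)-\lambda}, \] \[ f_{p,C,\lambda}(r,r_1,r_2)=\lambda\sum_{j=1}^{s(p)}\frac{\alpha(p^{s(p)})}{\alpha(p^j)}+\sum_{j=1}^{s(p)}\left(\left\lfloor\frac{r}{\alpha(p^j)}\right\rfloor-\left\lfloor\frac{r_1}{\alpha(p^j)}\right\rfloor-\left\lfloor\frac{r_2}{\alpha(p^j)}\right\rfloor\right). \]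
   Context: A strong divisibility sequence is a sequence $C=C_1,C_2,\dots$ of nonzero integers with $\gcd(C_n,C_m)=C_{\gcd(n,m)}$ for all positive $n,m$. The $C$-orial is $0!_C=1$, $n!_C=C_nC_{n-1}\cdots C_1$ for $n\ge1$, and $\binom{n}{m}_C=\frac{n!_C}{m!_C(n-m)!_C}$ for $0\le m\le n$. For a prime $p$, $\nu_p$ is the $p$-adic valuation and $T_{p,C}(n,x)=\sum_{m=0}^n x^{\nu_p(\binom{n}{m}_C)}$. The rank of apparition $\alpha(m)$ is the least index $j\ge1$ with $m\mid C_j$ (if it exists). When $\alpha(p^k)$ exists for all $k\ge1$, set $a_1(p)=\alpha(p)$ and $a_k(p)=\alpha(p^k)/\alpha(p^{k-1})$ for $k\ge2$. The prime $p$ is acceptable for $C$ if $\alpha(p^k)$ exists for all $k\ge1$ and there is an integer $s(p)\ge1$ such that $a_k(p)$ is a (positive) integer for $2\le k\le s(p)$ and $a_k(p)=p$ for $k>s(p)$. For $d\in\{0,1,\dots,p-1\}$, $M_p(d)=\begin{bmatrix} d+1 & p-d-1\\ dx & (p-d)x\end{bmatrix}$. *)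

(* Defs.v *)
From mathcomp Require Import all_boot all_order all_algebra.
From mathcomp Require Import ring zify.
From mathcomp Require Import boolp.

Set Implicit Arguments.
Unset Strict Implicit.
Unset Printing Implicit Defensive.

Import Order.TTheory GRing.Theory Num.Theory.
Local Open Scope ring_scope.

(* Sequences (C_n) indexed by n >= 1 are functions nat -> int; the value C 0 is
   never constrained nor used. *)

Definition strong_divisibility (C : nat -> int) : Prop :=
  (forall n : nat, (0 < n)%N -> C n != 0) /\
  (forall n m : nat, (0 < n)%N -> (0 < m)%N ->
     gcdz (C n) (C m) = C (gcdn n m)).

Definition Corial (C : nat -> int) (n : nat) : int :=
  \prod_(1 <= i < n.+1) C i.

(* The quotient is exact for m <= n: see CbinomK. *)
Definition Cbinom (C : nat -> int) (n m : nat) : int :=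
  (Corial C n %/ (Corial C m * Corial C (n - m)))%Z.

Lemma Corial0 C : Corial C 0 = 1.
Proof. by rewrite /Corial big_geq. Qed.

Lemma CorialS C n : Corial C n.+1 = Corial C n * C n.+1.
Proof. by rewrite /Corial big_nat_recr. Qed.

Lemma Corial_neq0 C n : strong_divisibility C -> Corial C n != 0.
Proof.
move=> [C0 _]; elim: n => [|n IHn]; first by rewrite Corial0.
by rewrite CorialS mulf_neq0 ?C0.
Qed.

Lemma dvdz_Corial C n m : strong_divisibility C -> (m <= n)%N ->
  (Corial C m * Corial C (n - m) %| Corial C n)%Z.
Proof.
move=> hC; elim: n m => [|n IHn] [|m] //= le_mn.
- by rewrite !Corial0.
- by rewrite subn0 Corial0 mul1r.
rewrite subSS; have [->|ne_mn] := eqVneq m n.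
  by rewrite subnn Corial0 mulr1.
have lt_mn : (m < n)%N by rewrite ltn_neqAle ne_mn.
have {ne_mn} [k nE] : exists k, (n - m = k.+1)%N.
  by exists (n - m).-1; rewrite prednK // subn_gt0.
have nkE : n.+1 = (m.+1 + k.+1)%N by rewrite -nE addSn subnKC.
have dvd_gcd : (gcdz (C m.+1) (C k.+1) %| C n.+1)%Z.
  rewrite hC.2 //; set g := gcdn _ _.
  have gn : (g %| n.+1)%N by rewrite nkE dvdn_add // ?dvdn_gcdl ?dvdn_gcdr.
  have g0 : (0 < g)%N by rewrite gcdn_gt0.
  by rewrite -{1}(gcdn_idPr gn) -hC.2 ?dvdz_gcdl.
have [a [b abE]] := Bezoutz (C m.+1) (C k.+1).
have [c cE] := dvdzP dvd_gcd.
have le1 : (m <= n)%N by rewrite ltnW.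
have d1 := IHn m le1; have d2 := IHn m.+1 lt_mn.
have n_m1 : (n - m.+1 = k)%N by rewrite subnS nE.
rewrite n_m1 in d2; rewrite nE in d1.
rewrite nE [Corial C n.+1]CorialS cE -abE mulrDr mulrDr; apply: rpredD.
  rewrite [Corial C m.+1]CorialS.
  rewrite (_ : _ * (c * _) = (Corial C n * C m.+1) * (c * a)); last by ring.
  by rewrite dvdz_mulr // mulrAC dvdz_mul.
rewrite [Corial C k.+1]CorialS.
rewrite (_ : _ * (c * _) = (Corial C n * C k.+1) * (c * b)); last by ring.
by apply: dvdz_mulr; rewrite mulrA; apply: dvdz_mul.
Qed.

Lemma CbinomK C n m : strong_divisibility C -> (m <= n)%N ->
  Cbinom C n m * (Corial C m * Corial C (n - m)) = Corial C n.
Proof. by move=> hC le_mn; rewrite divzK ?dvdz_Corial. Qed.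

Definition T_poly (C : nat -> int) (p n : nat) : {poly int} :=
  \sum_(0 <= m < n.+1) 'X^(logn p `|Cbinom C n m|%N).

Definition has_rank (C : nat -> int) (m : nat) : Prop :=
  exists j : nat, (0 < j)%N && (m%:Z %| C j)%Z.

(* The rank of apparition, with the value 0 when it does not exist. *)
Definition alpha (C : nat -> int) (m : nat) : nat :=
  if pselect (has_rank C m) is left e then ex_minn e else 0%N.

Lemma alphaP C m : has_rank C m ->
  [/\ (0 < alpha C m)%N, (m%:Z %| C (alpha C m))%Z &
      forall j, (0 < j)%N -> (m%:Z %| C j)%Z -> (alpha C m <= j)%N].
Proof.
rewrite /alpha; case: pselect => // e _.
by case: ex_minnP => j /andP[j0 dj] jmin; split=> // i i0 di; apply: jmin; rewrite i0.
Qed.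

(* a_k(p), for k >= 1. *)
Definition rank_ratio (C : nat -> int) (p k : nat) : rat :=
  if k == 1%N then (alpha C p)%:R
  else (alpha C (p ^ k))%:R / (alpha C (p ^ k.-1))%:R.

(* p is acceptable for C, with s as a possible value of s(p). *)
Definition acceptable (C : nat -> int) (p s : nat) : Prop :=
  [/\ prime p,
      (forall k : nat, (1 <= k)%N -> has_rank C (p ^ k)),
      (1 <= s)%N,
      (forall k : nat, (2 <= k <= s)%N ->
         rank_ratio C p k \is a Num.int /\ 0 < rank_ratio C p k) &
      (forall k : nat, (s < k)%N -> rank_ratio C p k = p%:R)].

Lemma dvdn_alpha C p s j : acceptable C p s -> (1 <= j <= s)%N ->
  (alpha C (p ^ j) %| alpha C (p ^ s))%N.
Proof.
move=> [_ hr _ hint _] /andP[j1 js].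
rewrite -(subnKC js); have : (j + (s - j) <= s)%N by rewrite subnKC.
elim: (s - j)%N => [|i IHi]; first by rewrite addn0.
rewrite addnS => lt_s; apply: dvdn_trans (IHi (ltnW lt_s)) _.
have ji0 : (0 < j + i)%N by rewrite addn_gt0 j1.
have [|] := hint (j + i).+1; first by rewrite ltnS ji0.
rewrite /rank_ratio /= eqSS -[_ == 0%N]negbK -lt0n ji0 /=.
have [a0 _ _] := alphaP (hr _ ji0).
move=> /intrP[z zE] _; apply/dvdnP.
have a0' : (alpha C (p ^ (j + i)))%:R != 0 :> rat by rewrite pnatr_eq0 -lt0n.
have := congr1 ( *%R^~ (alpha C (p ^ (j + i)))%:R) zE.
rewrite /= divfK // => zE'; exists `|z|%N.
have {zE'} : (alpha C (p ^ (j + i).+1))%:Z = z * (alpha C (p ^ (j + i)))%:Z.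
  by apply: (@intr_inj rat); rewrite intrM -!pmulrn.
by move/(congr1 absz); rewrite abszM.
Qed.

(* The division alpha(p^s) %/ alpha(p^j) is exact by dvdn_alpha. *)
Definition f_exp (C : nat -> int) (p s lambda r r1 r2 : nat) : int :=
  lambda%:Z * \sum_(1 <= j < s.+1)
                (alpha C (p ^ s) %/ alpha C (p ^ j))%N%:Z
  + \sum_(1 <= j < s.+1)
      ((r %/ alpha C (p ^ j))%N%:Z - (r1 %/ alpha C (p ^ j))%N%:Z
                                   - (r2 %/ alpha C (p ^ j))%N%:Z).

Lemma f_exp_ge C p s lambda r r1 r2 : acceptable C p s ->
  (r < alpha C (p ^ s))%N -> (r1 < alpha C (p ^ s))%N ->
  (r2 < alpha C (p ^ s))%N ->
  (r1 + r2 = r + lambda * alpha C (p ^ s))%N ->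
  lambda%:Z <= f_exp C p s lambda r r1 r2.
Proof.
move=> hp hr hr1 hr2 rE; have [_ hrank s1 _ _] := hp.
rewrite /f_exp mulr_sumr -big_split /= big_nat_recr //=.
rewrite (divn_small hr) (divn_small hr1) (divn_small hr2).
rewrite divnn (leq_ltn_trans _ hr) //= -[leLHS]add0r lerD //; last by lia.
rewrite big_nat_cond sumr_ge0 // => j; rewrite andbT => /andP[j1 js].
have dj : (alpha C (p ^ j) %| alpha C (p ^ s))%N.
  by apply: dvdn_alpha hp _; rewrite j1 ltnW.
have : (r1 %/ alpha C (p ^ j) + r2 %/ alpha C (p ^ j) <=
        lambda * (alpha C (p ^ s) %/ alpha C (p ^ j)) + r %/ alpha C (p ^ j))%N.
  rewrite muln_divA // -(divnDl r) ?dvdn_mull //.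
  rewrite [(lambda * _ + _)%N]addnC -rE divnD ?leq_addr //.
  by have [] := alphaP (hrank j j1).
by lia.
Qed.

(* The exponent is nonnegative by f_exp_ge. *)
Definition u_entry (C : nat -> int) (p s lambda r : nat) : {poly int} :=
  \sum_(q : 'I_(alpha C (p ^ s)) * 'I_(alpha C (p ^ s))
          | (q.1 + q.2 == r + lambda * alpha C (p ^ s))%N)
     'X^(`|f_exp C p s lambda r q.1 q.2 - lambda%:Z|%N).

Definition u_row (C : nat -> int) (p s r : nat) : 'rV[{poly int}]_2 :=
  \row_(lambda < 2) u_entry C p s lambda r.

Definition M_mx (p d : nat) : 'M[{poly int}]_2 :=
  \matrix_(i < 2, j < 2)
    if i == 0 then (if j == 0 then d%:R + 1 else p%:R - d%:R - 1)
    else (if j == 0 then d%:R * 'X else (p%:R - d%:R) * 'X).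

(* ds = [:: n_0; n_1; ...; n_l], least significant digit first; no leading
   zero, except that 0 is represented by [:: 0]. *)
Definition base_repr (p n : nat) (ds : seq nat) : Prop :=
  [/\ (0 < size ds)%N,
      (forall d : nat, d \in ds -> (d < p)%N),
      ((1 < size ds)%N -> last 0%N ds != 0%N) &
      n = (\sum_(0 <= i < size ds) nth 0%N ds i * p ^ i)%N].

(* Main.v *)
(* Since p^k divides C_j exactly when alpha(p^k) divides j, a Legendre-type count
   shows that the valuation of binom(a + b, a)_C is the number of carries when a
   and b are added in the mixed-radix system with place values alpha(p^k).  By
   acceptability alpha(p^(s+i)) = alpha(p^s) p^i, so a pair (a, b) splits into
   residues mod alpha(p^s), which contribute the row u(r), and quotients, which
   are added in ordinary base p with the carry lambda coming from the residues.
   Peeling off one base-p digit of the quotients is a transfer step: the entry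
   (lambda, mu) of M_p(d) is x^lambda times the number of digit pairs that, with
   incoming carry lambda, produce the digit d and the outgoing carry mu. *)
Require Import Defs.
From mathcomp Require Import all_boot all_order all_algebra.
From mathcomp Require Import ring zify.
Import Order.TTheory GRing.Theory Num.Theory.

(** * Valuations as counts *)

Lemma sum_ord_lt (p t : nat) : t <= p -> \sum_(e < p) (e < t) = t.
Proof.
move=> tp; rewrite -(big_mkord xpredT (fun e => (e < t) : nat)).
rewrite (big_cat_nat (leq0n t) tp) /= big_nat_cond (eq_bigr (fun=> 1)); last first.
  by move=> i /andP[/andP[_ ->]].
rewrite -big_nat_cond sum_nat_const_nat muln1 subn0 big_nat_cond big1 ?addn0 //.
by move=> i /andP[/andP[ti _] _]; rewrite ltnNge ti.
Qed.

Lemma logn_sum_dvdn (p m L : nat) : prime p -> 0 < m -> logn p m <= L ->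
  logn p m = \sum_(1 <= k < L.+1) (p ^ k %| m).
Proof.
move=> pp m0 lL.
rewrite big_add1 big_mkord -[LHS](@sum_ord_lt L) //.
by apply: eq_bigr => k _; rewrite pfactor_dvdn.
Qed.

(** * Addition one digit at a time *)

(** For [n = a + b + mu] with an incoming carry [mu <= 1], the [i]-th term is the carry into place
    [i]; [mu] itself, the carry into place 0, is left out. *)
Definition carries (p k n a b : nat) : nat :=
  \sum_(1 <= i < k.+1) (n %/ p ^ i - (a %/ p ^ i + b %/ p ^ i)).

(** The [i = 1] term is [n - (a + b) = mu]; one division by [p] turns each later term into the
    preceding one for the quotients. *)
Lemma carries_digit (p k n d a b e1 e2 mu lambda : nat) :
  0 < p -> d < p -> e1 < p -> e2 < p -> a + b + mu = n ->
  carries p k.+1 (n * p + d) (a * p + e1) (b * p + e2) = mu + carries p k n a b.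
Proof.
move=> p0 dp e1p e2p <-.
have digit m e : e < p -> (m * p + e) %/ p = m.
  by move=> ep; rewrite divnMDl // divn_small // addn0.
rewrite /carries big_nat_recl //= expn1 !digit //; congr (_ + _); first by lia.
by apply: eq_big_nat => i _; rewrite expnS !divnMA !digit.
Qed.

Lemma sum_ordMn (R : nmodType) (K B : nat) (F : nat -> R) :
  (\sum_(i < K * B) F i = \sum_(a < K) \sum_(e < B) F (a * B + e)%N)%R.
Proof.
rewrite -(big_mkord xpredT F) big_nat_mul big_mkord; apply: eq_bigr => a _.
by rewrite mulSn -{1}[a * B]add0n big_addn addnK big_mkord; apply: eq_bigr => e _; rewrite addnC.
Qed.

(* Addition with incoming carry [lambda] and outgoing carry [mu] in the lowest
   digit. *)
Lemma antidiag_digit (R : nmodType) (K B lambda n d : nat) (F : nat -> nat -> R) :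
  d < B -> lambda <= 1 ->
  (\sum_(a < K * B) \sum_(b < K * B | (a + b + lambda == n * B + d)%N) F a b =
   \sum_(mu < 2)
     \sum_(q : 'I_B * 'I_B | (q.1 + q.2 + lambda == d + mu * B)%N)
       \sum_(a < K) \sum_(b < K | (a + b + mu == n)%N)
         F (a * B + q.1)%N (b * B + q.2)%N)%R.
Proof.
move=> dB l1.
(* Guards become zero terms, so that all ranges are independent and the sums can be exchanged. *)
pose c (P : bool) (x : R) : R := if P then x else 0%R.
have -> : (\sum_(a < K * B) \sum_(b < K * B | (a + b + lambda == n * B + d)%N) F a b)%R =
  (\sum_(a < K) \sum_(e1 < B) \sum_(b < K) \sum_(e2 < B)
     \sum_(mu < 2) c ((e1 + e2 + lambda == d + mu * B) && (a + b + mu == n))%N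
        (F (a * B + e1)%N (b * B + e2)%N))%R.
  rewrite (sum_ordMn _ _ _ (fun a => \sum_(b < K * B | (a + b + lambda == n * B + d)%N) F a b)%R).
  apply: eq_bigr => a _; apply: eq_bigr => e1 _; rewrite big_mkcond /=.
  rewrite (sum_ordMn _ _ _ (fun b => if (a * B + e1 + b + lambda == n * B + d)%N
     then F (a * B + e1)%N b else 0)%R).
  apply: eq_bigr => b _; apply: eq_bigr => e2 _.
  rewrite 2!big_ord_recl big_ord0 /= /c mul0n mul1n !addn0 addr0.
  have l0 := ltn_ord e1; have l2 := ltn_ord e2.
  (* Since [e1 + e2 + lambda < 2 * B], the outgoing carry is 0 or 1; remainder and quotient by [B]
     then separate the digits from the rest. *)
  have E : (a * B + e1 + (b * B + e2) + lambda == n * B + d) =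
    (e1 + e2 + lambda == d) && (a + b == n) ||
    (e1 + e2 + lambda == d + B) && (a + b + 1 == n).
    apply/idP/idP => [/eqP H|/orP[]/andP[/eqP H1 /eqP H2]]; last 2 first.
    - by apply/eqP; nia.
    - by apply/eqP; nia.
    have [lt|ge] := ltnP (e1 + e2 + lambda) B.
      have := congr1 (divn^~ B) H; have := congr1 (modn^~ B) H.
      have -> : a * B + e1 + (b * B + e2) + lambda = (a + b) * B + (e1 + e2 + lambda) by lia.
      rewrite !modnMDl !modn_small // !divnMDl ?(leq_trans _ dB) //.
      by rewrite !divn_small // !addn0 => -> ->; rewrite !eqxx.
    have := congr1 (divn^~ B) H; have := congr1 (modn^~ B) H.
    have -> : a * B + e1 + (b * B + e2) + lambda = (a + b + 1) * B + (e1 + e2 + lambda - B) by nia.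
    have lt : e1 + e2 + lambda - B < B by lia.
    rewrite !modnMDl !modn_small // !divnMDl ?(leq_trans _ dB) //.
    rewrite !divn_small // !addn0 => H1 ->; rewrite eqxx andbT.
    by apply/orP; right; apply/eqP; lia.
  rewrite E; have [->|/negPf E1] := eqVneq (e1 + e2 + lambda) d.
    have -> : (d == d + B) = false by lia.
    by rewrite andTb andFb orbF addr0; case: ifP.
  by rewrite andFb orFb add0r; case: ifP.
rewrite [RHS](eq_bigr (fun mu : 'I_2 => \sum_(e1 < B) \sum_(e2 < B) \sum_(a < K) \sum_(b < K)
  c ((e1 + e2 + lambda == d + mu * B) && (a + b + mu == n))%N
        (F (a * B + e1)%N (b * B + e2)%N))%R); last first.
  move=> mu _; rewrite pair_bigA big_mkcond /=; apply: eq_bigr => q _.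
  case: ifP => [E|_]; last by rewrite big1 // => a _; rewrite big1.
  by apply: eq_bigr => a _; rewrite big_mkcond.
rewrite exchange_big.
under eq_bigr => e1 _.
  under eq_bigr => a _.
    under eq_bigr => b _ do rewrite exchange_big.
    rewrite exchange_big; over.
  rewrite exchange_big; over.
rewrite exchange_big; apply: eq_bigr => mu _; apply: eq_bigr => e1 _.
under eq_bigr => a _ do rewrite exchange_big.
by rewrite exchange_big.
Qed.

(** These counts are the entries [(lambda, mu)] of [M_mx p d] without the factor ['X^lambda]. *)
Lemma card_digit_pairs (p d lambda mu : nat) :
  d < p -> lambda <= 1 -> mu <= 1 ->
  \sum_(q : 'I_p * 'I_p | q.1 + q.2 + lambda == d + mu * p) 1 =
  if mu == 0 then d + 1 - lambda else p - (d + 1 - lambda).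
Proof.
move=> dp l1 m1.
rewrite -(pair_big_dep xpredT (fun a b : 'I_p => a + b + lambda == d + mu * p)
  (fun _ _ => 1)) /=.
(* For fixed [a] the only candidate is [b = d + mu * p - lambda - a]; the right side tests whether
   it is a digit. *)
have E (a : 'I_p) : \sum_(b < p | a + b + lambda == d + mu * p) 1 =
    (a + lambda <= d + mu * p) && (d + mu * p < p + a + lambda).
  case: andP => [[h1 h2]|h].
    have lt : d + mu * p - lambda - a < p by lia.
    rewrite (big_pred1 (Ordinal lt)) // => b /=; rewrite -val_eqE /=; lia.
  by rewrite big1 // => b /eqP ab; case: h; have := ltn_ord b; lia.
rewrite (eq_bigr _ (fun a _ => E a)).
case: mu m1 {E} => [|[|]] //= _.
  rewrite -[RHS](@sum_ord_lt p); last by lia.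
  by apply: eq_bigr => a _; have := ltn_ord a; lia.
(* For [mu = 1] the admissible [a] are those rejected for [mu = 0], so the two counts add up to
   [p]. *)
apply/eqP; rewrite -(eqn_add2r (d + 1 - lambda)) subnK; last by lia.
rewrite -{1}[d + 1 - lambda](@sum_ord_lt p); last by lia.
rewrite -big_split /=.
rewrite (eq_bigr (fun=> 1)) ?sum_nat_const ?card_ord ?muln1 // => a _.
by have := ltn_ord a; lia.
Qed.

(** * Ranks of apparition and valuations of [Cbinom] *)

(** By strong divisibility [m] also divides the term at index [gcdn (alpha C m) j], and minimality
    of the rank forces this gcd to be [alpha C m]. *)
Lemma dvdz_alpha (C : nat -> int) (m j : nat) :
  strong_divisibility C -> has_rank C m -> 0 < j ->
  (m%:Z %| C j)%Z = (alpha C m %| j).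
Proof.
move=> [_ hC] /alphaP[a0 da amin] j0; apply/idP/idP => [dj|/gcdn_idPl aj].
  have g0 : 0 < gcdn (alpha C m) j by rewrite gcdn_gt0 a0.
  have := amin _ g0; rewrite -hC // dvdz_gcd da dj => /(_ isT) le_ag.
  by apply/gcdn_idPl/eqP; rewrite eqn_leq le_ag dvdn_leq ?dvdn_gcdl.
by apply: dvdz_trans da _; rewrite -{1}aj -hC // dvdz_gcdr.
Qed.

Lemma alpha_expD (C : nat -> int) (p s i : nat) : acceptable C p s ->
  alpha C (p ^ (s + i)) = alpha C (p ^ s) * p ^ i.
Proof.
move=> [_ hr s1 _ hs]; elim: i => [|i IHi]; first by rewrite addn0 muln1.
have [a0 _ _] := alphaP (hr (s + i) ltac:(lia)).
have := hs (s + i).+1 ltac:(lia).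
rewrite /rank_ratio ifF; last by lia.
move/(congr1 ( *%R^~ (alpha C (p ^ (s + i)))%:R)%R).
rewrite /= divfK ?pnatr_eq0 -?lt0n // -natrM => /eqP.
by rewrite eqr_nat -addnS IHi expnS => /eqP->; rewrite mulnCA.
Qed.

(** Legendre's formula, with [alpha C (p ^ k)] in place of [p ^ k]. *)
Lemma logn_Corial (C : nat -> int) (p s L N : nat) :
  strong_divisibility C -> acceptable C p s -> N < alpha C (p ^ L.+1) ->
  logn p `|Corial C N| = \sum_(1 <= k < L.+1) N %/ alpha C (p ^ k).
Proof.
move=> hC [pp hr _ _ _]; elim: N => [|N IHN] ltN.
  by rewrite Corial0 logn1 big1 // => k _; rewrite div0n.
have C0 : 0 < `|C N.+1| by rewrite absz_gt0 hC.1.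
rewrite CorialS abszM lognM // ?absz_gt0 ?Corial_neq0 // IHN ?(ltnW ltN) //.
have dvdE k : 0 < k -> (p ^ k %| `|C N.+1|) = (alpha C (p ^ k) %| N.+1).
  by move=> k0; rewrite -(dvdz_alpha C (p ^ k) N.+1 hC (hr k k0) isT).
rewrite (@logn_sum_dvdn p `|C N.+1| L) //; last first.
  (* If [p ^ L.+1] divided [C N.+1], then [alpha C (p ^ L.+1) <= N.+1]; hence the sum may stop at
     [L]. *)
  rewrite leqNgt -pfactor_dvdn // dvdE //.
  by apply: contraL ltN => /dvdn_leq -/(_ isT); rewrite -leqNgt.
rewrite -big_split /= big_nat [RHS]big_nat; apply: eq_bigr => k /andP[k1 _].
have [a0 _ _] := alphaP (hr k k1).
by rewrite (divnS _ a0) (dvdE k k1) addnC.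
Qed.

Local Open Scope ring_scope.

Lemma logn_Cbinom (C : nat -> int) (p s L a b : nat) :
  strong_divisibility C -> acceptable C p s -> (a + b < alpha C (p ^ L.+1))%N ->
  (logn p `|Cbinom C (a + b) a|%N)%:Z =
  \sum_(1 <= k < L.+1) (((a + b) %/ alpha C (p ^ k))%N%:Z
     - (a %/ alpha C (p ^ k))%N%:Z - (b %/ alpha C (p ^ k))%N%:Z).
Proof.
move=> hC hp ltL.
have Cor0 m : (0 < `|Corial C m|)%N by rewrite absz_gt0 Corial_neq0.
have K := CbinomK hC (leq_addr b a).
have B0 : Cbinom C (a + b) a != 0.
  by apply: contraTneq (Corial_neq0 (a + b) hC) => B0; rewrite -K B0 mul0r eqxx.
move/(congr1 (fun z : int => logn p `|z|%N)): K; rewrite !abszM addKn.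
rewrite !lognM ?muln_gt0 ?Cor0 ?absz_gt0 //.
rewrite !(logn_Corial _ _ s L) //; [|lia..].
rewrite !sumrB.
have E (F : nat -> nat) : \sum_(1 <= k < L.+1) (F k)%:Z = (\sum_(1 <= k < L.+1) F k)%N%:Z.
  by rewrite (big_morph Posz PoszD (erefl _)).
by rewrite !E => <-; rewrite !PoszD; ring.
Qed.

(** Levels up to [s] yield [f_exp]; higher levels see only the quotients and yield [carries]. The
    [mu] removed from [f_exp] returns as an incoming carry, matching the exponents in [u_entry] and
    [carry_sum]. *)
Lemma logn_Cbinom_digits (C : nat -> int) (p s k n r mu q1 q2 a b : nat) :
  strong_divisibility C -> acceptable C p s -> (n < p ^ k)%N ->
  (r < alpha C (p ^ s))%N -> (q1 < alpha C (p ^ s))%N ->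
  (q2 < alpha C (p ^ s))%N -> (q1 + q2 = r + mu * alpha C (p ^ s))%N ->
  (a + b + mu = n)%N ->
  logn p `|Cbinom C (alpha C (p ^ s) * n + r) (a * alpha C (p ^ s) + q1)|%N =
  (`|f_exp C p s mu r q1 q2 - mu%:Z| + (mu + carries p k n a b))%N.
Proof.
move=> hC hp npk rA q1A q2A qE nE; set A := alpha C (p ^ s) in rA q1A q2A qE *.
have [pp hrank s1 _ _] := hp; have p0 := prime_gt0 pp.
have NE : (A * n + r = (a * A + q1) + (b * A + q2))%N by nia.
apply/eqP; rewrite -eqz_nat; apply/eqP; rewrite NE.
(* The cutoff is valid because [A * n + r < A * p ^ k <= alpha C (p ^ (s + k).+1)]. *)
rewrite (logn_Cbinom C p s (s + k)) //; last first.
  rewrite -NE -[(s + k).+1]addnS alpha_expD // -/A.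
  apply: (@leq_trans (A * p ^ k)); first by nia.
  by rewrite leq_mul2l leq_exp2l ?prime_gt1 ?leqnSn ?orbT.
rewrite !PoszD gez0_abs; last by rewrite subr_ge0 f_exp_ge.
rewrite [mu%:Z + _]addrC [RHS]addrA addrAC subrK -NE.
rewrite (@big_cat_nat _ _ _ s.+1) //=; last by rewrite ltnS leq_addr.
congr (_ + _).
  rewrite /f_exp mulr_sumr -big_split /= big_nat [RHS]big_nat.
  apply: eq_bigr => j /andP[j1 js].
  (* The multiples of [A] contribute [c * (n - a - b) = c * mu], the first sum in [f_exp]. *)
  have /dvdnP[c AE] : (alpha C (p ^ j) %| A)%N by apply: dvdn_alpha hp _; rewrite j1.
  have [a0 _ _] := alphaP (hrank j j1).
  rewrite -/A AE mulnK // !mulnA -[(_ * alpha C _ * n)%N]mulnAC !divnMDl //.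
  by rewrite -nE !PoszD !PoszM !PoszD; ring.
have digit m q : (q < A)%N -> ((m * A + q) %/ A = m)%N.
  by move=> qA; rewrite divnMDl ?(leq_ltn_trans _ qA) // divn_small // addn0.
rewrite -{1}[s.+1]addn1 addnC big_addn -addnS addKn.
rewrite /carries (big_morph Posz PoszD (erefl _)).
rewrite big_nat [RHS]big_nat; apply: eq_bigr => i _.
rewrite [(i + s)%N]addnC alpha_expD // -/A !divnMA mulnC !digit //.
(* This makes the truncated subtraction in [carries] agree with the integer one. *)
have : (a %/ p ^ i + b %/ p ^ i <= n %/ p ^ i)%N.
  rewrite -nE (leq_trans _ (leq_div2r _ (leq_addr mu (a + b)))) //.
  by rewrite divnD ?expn_gt0 ?p0 // leq_addr.
lia.
Qed.

(** * Transfer recursion on the base-[p] digits *)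

(** Component [lambda] of the transfer state; the extra [lambda] in the exponent records the
    incoming carry, which [carries] omits. *)
Definition carry_sum (p k n lambda : nat) : {poly int} :=
  \sum_(a < p ^ k) \sum_(b < p ^ k | (a + b + lambda == n)%N)
     'X^(lambda + carries p k n a b).

Lemma carry_sum_digit (p k n d lambda : nat) : (d < p)%N -> (lambda <= 1)%N ->
  carry_sum p k.+1 (n * p + d) lambda =
  'X^lambda * ((d + 1 - lambda)%N%:R * carry_sum p k n 0
               + (p - (d + 1 - lambda))%N%:R * carry_sum p k n 1).
Proof.
move=> dp l1; have p0 : (0 < p)%N by apply: leq_trans dp.
rewrite /carry_sum expnSr.
rewrite (antidiag_digit _ _ _ _ _ _
  (fun a b => 'X^(lambda + carries p k.+1 (n * p + d) a b))) //.
(* Once [mu] is fixed, the summand does not depend on the digit pair, so the pairs contribute only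
   their number. *)
have E (mu : 'I_2) :
   \sum_(q : 'I_p * 'I_p | (q.1 + q.2 + lambda == d + mu * p)%N)
     \sum_(a < p ^ k) \sum_(b < p ^ k | (a + b + mu == n)%N)
       'X^(lambda + carries p k.+1 (n * p + d) (a * p + q.1) (b * p + q.2)) =
   'X^lambda *
   ((if mu == 0 :> nat then d + 1 - lambda else p - (d + 1 - lambda))%N%:R
     * carry_sum p k n mu) :> {poly int}.
  rewrite -(card_digit_pairs p d lambda mu) //; last by have := ltn_ord mu.
  rewrite natr_sum mulr_suml mulr_sumr; apply: eq_bigr => q _.
  rewrite mul1r mulr_sumr; apply: eq_bigr => a _.
  rewrite mulr_sumr; apply: eq_bigr => b /eqP nE.
  by rewrite -exprD (@carries_digit _ _ _ _ _ _ _ _ mu).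
by rewrite 2!big_ord_recl big_ord0 addr0 !E /= mulrDr.
Qed.

Lemma prod_M_mx (p : nat) (ds : seq nat) : (0 < p)%N ->
  (forall d : nat, d \in ds -> (d < p)%N) ->
  (\prod_(d <- ds) M_mx p d) *m (\col_(i < 2) (i == 0)%:R) =
  \col_(i < 2) carry_sum p (size ds) (foldr (fun d n => n * p + d)%N 0%N ds) i.
Proof.
move=> p0; elim: ds => [|d ds IHds] hds.
  (* With no digits only the pair [(0, 0)] remains, and it requires incoming carry 0; this is the
     final column. *)
  rewrite big_nil mul1mx; apply/colP => i; rewrite !mxE /carry_sum /=.
  rewrite big_ord1; case: i => [[|[|//]] ip] /=.
    by rewrite big_mkcond big_ord1 /= /carries big_geq.
  by rewrite big_mkcond big_ord1.
have dp : (d < p)%N by rewrite hds ?mem_head.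
rewrite big_cons -mulmxE -mulmxA IHds; last first.
  by move=> e eds; rewrite hds // inE eds orbT.
apply/colP => i; rewrite !mxE 2!big_ord_recl big_ord0 addr0 !mxE /=.
case: i => [[|[|//]] ip] /=; rewrite carry_sum_digit //.
  rewrite subn0 expr0 mul1r natrB; last by rewrite addn1.
  by rewrite !natrD; ring.
by rewrite addnK natrB ?(ltnW dp) //; ring.
Qed.

Lemma base_repr_foldr (p n : nat) (ds : seq nat) : (0 < p)%N -> base_repr p n ds ->
  n = foldr (fun d n => n * p + d)%N 0%N ds /\ (n < p ^ size ds)%N.
Proof.
move=> p0 [_ hds _ nE].
have {nE} nE : n = foldr (fun d n => n * p + d)%N 0%N ds.
  rewrite {}nE {hds}; elim: ds => [|d ds IHds]; first by rewrite big_geq.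
  rewrite /= big_nat_recl //= expn0 muln1 -IHds addnC big_distrl /=.
  by congr (_ + _)%N; apply: eq_bigr => i _; rewrite expnSr mulnA.
split=> //; rewrite {}nE; elim: ds hds => [|d ds IHds] hds //=.
have dp := hds d (mem_head _ _).
have : (foldr (fun d n => n * p + d) 0 ds < p ^ size ds)%N.
  by apply: IHds => e eds; rewrite hds // inE eds orbT.
by rewrite expnS; nia.
Qed.

(** The residue modulo [alpha C (p ^ s)] acts as a lowest digit with incoming carry 0; its outgoing
    carry enters the base-[p] part. *)
Lemma T_poly_digits (C : nat -> int) (p s k n r : nat) :
  strong_divisibility C -> acceptable C p s -> (n < p ^ k)%N ->
  (r < alpha C (p ^ s))%N ->
  T_poly C p (alpha C (p ^ s) * n + r) =
  u_entry C p s 0 r * carry_sum p k n 0 + u_entry C p s 1 r * carry_sum p k n 1.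
Proof.
move=> hC hp npk rA; set A := alpha C (p ^ s).
set N := (A * n + r)%N; pose F a : {poly int} := 'X^(logn p `|Cbinom C N a|%N).
have NA : (N < p ^ k * A)%N by rewrite /N; nia.
(* Each [a <= N] is paired with the unique [b = N - a], and larger [a] have no partner. *)
transitivity (\sum_(a < p ^ k * A) \sum_(b < p ^ k * A | (a + b + 0 == n * A + r)%N) F a).
  rewrite /T_poly -/N (big_nat_widen _ _ (p ^ k * A)) // big_mkord big_mkcond /=.
  apply: eq_bigr => a _; case: ifP => [aN|aN]; last first.
    by rewrite big1 // => b /eqP; move: aN; rewrite /N; lia.
  have lt : (N - a < p ^ k * A)%N by apply: leq_ltn_trans NA; rewrite leq_subr.
  rewrite (big_pred1 (Ordinal lt)) // => b.
  by rewrite /= -val_eqE /=; move: aN; rewrite /N; lia.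
rewrite (antidiag_digit _ _ _ _ _ _ (fun a _ => F a)) // 2!big_ord_recl big_ord0 addr0.
have E (mu : 'I_2) :
   \sum_(q : 'I_A * 'I_A | (q.1 + q.2 + 0 == r + mu * A)%N)
     \sum_(a < p ^ k) \sum_(b < p ^ k | (a + b + mu == n)%N) F (a * A + q.1)%N =
   u_entry C p s mu r * carry_sum p k n mu.
  rewrite /u_entry mulr_suml; apply: eq_big => [q|q /eqP qE]; first by rewrite addn0.
  rewrite mulr_sumr; apply: eq_bigr => a _.
  rewrite mulr_sumr; apply: eq_bigr => b /eqP nE.
  by rewrite -exprD /F (@logn_Cbinom_digits C p s k n r mu q.1 q.2 a b) // -qE addn0.
by rewrite !E.
Qed.

Theorem theorem1p2 (C : nat -> int) (p s : nat)
  (hC : strong_divisibility C) (hp : acceptable C p s)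
  (n : nat) (ds : seq nat) (hn : base_repr p n ds)
  (r : nat) (hr : (r < alpha C (p ^ s))%N) :
  T_poly C p (alpha C (p ^ s) * n + r) =
  (u_row C p s r *m (\prod_(d <- ds) M_mx p d) *m (\col_(i < 2) (i == 0)%:R)) 0 0.
Proof.
have p0 : (0 < p)%N by have [/prime_gt0] := hp.
have [nE np] := base_repr_foldr p n ds p0 hn; have [_ hds _ _] := hn.
rewrite -mulmxA prod_M_mx // -nE (T_poly_digits C p s (size ds)) //.
by rewrite !mxE 2!big_ord_recl big_ord0 addr0 !mxE.
Qed.
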